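(* Let $Q$ be a set of $m$ points of $\mathbb{R}^d$ such that its convex hull $\operatorname{conv} Q$ contains the Euclidean unit ball $\mathbf{B}^d$. Then there is a subset $Q' \subset Q$ of size at most $2d$ satisfying \[ \operatorname{conv} Q' \supset r\,\mathbf{B}^d, \qquad \text{where } r = \frac{1}{2(m+d)+1}. \]
   Context: $\mathbf{B}^d$ denotes the standard closed Euclidean unit ball in $\mathbb{R}^d$ centered at the origin, and $r\,\mathbf{B}^d$ is its dilate by the factor $r$. Here $d$ and $m$ are positive integers. *)

(* Defs.v *)
From HB Require Import structures.
From mathcomp Require Import all_boot all_order all_algebra finmap.
From mathcomp Require Import boolp classical_sets reals convex.

Set Implicit Arguments.
Unset Strict Implicit.
Unset Printing Implicit Defensive.

Import Order.TTheory GRing.Theory Num.Theory.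

Local Open Scope classical_set_scope.
Local Open Scope ring_scope.

Definition convex_hull (R : realType) (d : nat) (A : set 'rV[R]_d) :
    set 'rV[R]_d :=
  smallest (fun C : set 'rV[R]_d => convex_set C) A.

(* The norm that the library puts on 'rV[R]_d is the sup norm, hence the
   explicit Euclidean norm. *)
Definition enorm (R : realType) (d : nat) (x : 'rV[R]_d) : R :=
  Num.sqrt (\sum_(i < d) x ord0 i ^+ 2).

Definition unit_ball (R : realType) (d : nat) : set 'rV[R]_d :=
  [set x | enorm x <= 1].

Definition dilate (R : realType) (d : nat) (r : R) (A : set 'rV[R]_d) :
    set 'rV[R]_d :=
  [set r *: x | x in A].
Arguments unit_ball : clear implicits.

(* Main.v *)
Require Import Defs.
From mathcomp Require Import all_boot all_order all_algebra finmap.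
From mathcomp Require Import boolp classical_sets reals convex.
From mathcomp Require Import unstable interval_inference topology normedtype.
From mathcomp Require Import derive.
From mathcomp Require Import lra ring.

Set Implicit Arguments.
Unset Strict Implicit.
Unset Printing Implicit Defensive.

Import Order.TTheory GRing.Theory Num.Theory.
Import numFieldNormedType.Exports.

Local Open Scope fset_scope.
Local Open Scope classical_set_scope.
Local Open Scope ring_scope.

(** The set conv Q contains the unit ball, and all points of the dilate of the
    ball by r have to be convex combinations of the same at most 2d points of Q.

    A projective change of coordinates balances Q. The polar set
    K = {c | <q, c> <= 1 for all q in Q} is compact, because conv Q contains
    the unit ball; let c maximize the product of the 1 - <q_i, c> over K (the
    analytic centre of K). Its optimality condition says that the rescaled
    points w_i = q_i / (1 - <q_i, c>) have sum zero ([analytic_center]). A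
    combination x = sum b_i w_i with b >= 0 is a convex combination of the
    q_i exactly when sum b_i = 1 - <x, c> ([cone_comb_rescale] and
    [cone_comb_unrescale]), so it is enough to control which total weights
    are attained by few of the w_i.

    Among the w_i choose d of them, w_e(1), ..., w_e(d), with the largest
    determinant in absolute value. By Cramer's rule all the w_i have
    coordinates in [-1, 1] in this basis ([max_volume_basis]). Since the w_i
    have sum zero, y = - sum_k w_e(k) is the sum of the other m - d points, a
    combination of total weight m - d; Caratheodory's argument rewrites it with
    at most d points without increasing the total weight
    ([conic_caratheodory]). The basis together with these points forms the
    subset of size at most 2d: a vector whose coordinates are at most h in
    absolute value is sum (a_k + h) w_e(k) + h y, a combination of total weight
    at most 2dh + (m - d)h = (m + d)h, and any larger weight is reached by
    adding a multiple of the relation sum_k w_e(k) + y = 0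
    ([centered_steinitz]).

    For x in the unit ball, |<x, c>| <= 1 because the ball is symmetric, so x
    has weight at most 2 with respect to all the w_i, and r x has weight at
    most h = 2r. The weight required for r x to lie in the hull of the chosen
    q_i is 1 - r <x, c> >= 1 - r, and (m + d) 2r <= 1 - r holds exactly when
    r <= 1 / (2(m + d) + 1) ([symmetric_steinitz]). *)

(** * Nonnegative combinations with prescribed total weight *)

(** Equivalently, (x, t) lies in the convex cone spanned by the lifted points
    (w i, 1), i in J. The support condition replaces a sum over J, so that
    coefficients for different J live on the same index type. *)
Definition cone_comb (R : realType) (I : finType) (V : lmodType R) (w : I -> V)
    (J : {set I}) (t : R) (x : V) : Prop :=
  exists b : I -> R, [/\ forall i, 0 <= b i, forall i, i \notin J -> b i = 0,
    \sum_i b i = t & \sum_i b i *: w i = x].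

Section ConeComb.
Variables (R : realType) (I : finType) (V : lmodType R) (w : I -> V).
Implicit Types (J : {set I}) (s t : R) (x y : V).

Lemma cone_combD J s t x y :
  cone_comb w J s x -> cone_comb w J t y -> cone_comb w J (s + t) (x + y).
Proof.
move=> [a [a0 aJ <- <-]] [b [b0 bJ <- <-]]; exists (fun i => a i + b i); split.
- by move=> i; rewrite addr_ge0.
- by move=> i iJ; rewrite aJ ?bJ ?addr0.
- by rewrite big_split.
- by rewrite -big_split; apply: eq_bigr => i _; rewrite scalerDl.
Qed.

Lemma cone_combZ J k t x :
  0 <= k -> cone_comb w J t x -> cone_comb w J (k * t) (k *: x).
Proof.
move=> k0 [b [b0 bJ <- <-]]; exists (fun i => k * b i); split.
- by move=> i; rewrite mulr_ge0.
- by move=> i iJ; rewrite bJ ?mulr0.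
- by rewrite mulr_sumr.
- by rewrite scaler_sumr; apply: eq_bigr => i _; rewrite scalerA.
Qed.

Lemma cone_comb_pt J i : i \in J -> cone_comb w J 1 (w i).
Proof.
move=> iJ; exists (fun j => (j == i)%:R); split.
- by move=> j; rewrite ler0n.
- by move=> j; case: eqVneq => // ->; rewrite iJ.
- by rewrite (bigD1 i)//= eqxx big1 ?addr0// => j /negPf->.
- rewrite (bigD1 i)//= eqxx scale1r big1 ?addr0// => j /negPf->.
  by rewrite scale0r.
Qed.

Lemma cone_comb0 J : cone_comb w J 0 0.
Proof. by exists (fun=> 0); split=> //; rewrite big1// => i _; rewrite scale0r. Qed.

Lemma cone_comb_sum J (K : finType) (P : pred K) (t : K -> R) (x : K -> V) :
  (forall k, P k -> cone_comb w J (t k) (x k)) ->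
  cone_comb w J (\sum_(k | P k) t k) (\sum_(k | P k) x k).
Proof.
move=> h; apply: (big_rec2 (fun x t => cone_comb w J t x)) => [|k y s Pk].
  exact: cone_comb0.
by apply: cone_combD; apply: h.
Qed.

Lemma cone_comb_sub J J' t x :
  J \subset J' -> cone_comb w J t x -> cone_comb w J' t x.
Proof.
move=> /fintype.subsetP sJ [b [b0 bJ bt bx]]; exists b; split=> // i iJ'.
by apply: bJ; apply: contra iJ' => /sJ.
Qed.

End ConeComb.

(** * Convex hulls as nonnegative combinations of weight one *)

Section Hull.
Variables (R : realType) (d : nat) (I : finType) (q : I -> 'rV[R]_d).

Lemma hull_cone_comb : convex_hull (range q) `<=` cone_comb q finset.setT 1.
Proof.
apply: smallest_sub => [x y l|_ [i _ <-]]; last first.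
  by apply: cone_comb_pt; rewrite finset.in_setT.
rewrite !inE => cx cy.
rewrite (_ : 1 = l%:num * 1 + (1 - l%:num) * 1); last by rewrite !mulr1 subrKC.
by apply: cone_combD; apply: cone_combZ => //; rewrite subr_ge0.
Qed.

Lemma cone_comb_hull (J : {set I}) x :
  cone_comb q J 1 x -> convex_hull (q @` [set` J]) x.
Proof.
move=> [b [b0 bJ b1 <-]] C [cC qC].
have [i0 Ci0] : exists i0, C (q i0).
  apply: contrapT => /forallNP h; suff: \sum_i b i = 0.
    by rewrite b1 => /eqP; rewrite oner_eq0.
  rewrite big1// => i _; apply: bJ; apply/negP => iJ.
  by apply: (h i); apply: qC; exists i.
(* A partial sum of weight t is t times a point of C; this form, unlike
   the convexity of C, passes through sums in which some weights vanish. *)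
suff [_ [z Cz]] : 0 <= \sum_i b i /\
    exists2 z, C z & \sum_i b i *: q i = (\sum_i b i) *: z.
  by rewrite b1 scale1r => ->.
apply: (big_ind2 (fun (x : 'rV_d) t => 0 <= t /\ exists2 z, C z & x = t *: z)).
- by split=> //; exists (q i0); rewrite ?scale0r.
- move=> _ s _ t [s0 [y Cy ->]] [t0 [z Cz ->]]; split; first exact: addr_ge0.
  have [st0|stN0] := eqVneq (s + t) 0.
    exists y => //; rewrite st0.
    have [-> ->] : s = 0 /\ t = 0 by lra.
    by rewrite !scale0r addr0.
  have stp : 0 < s + t by rewrite lt_def stN0 addr_ge0.
  have l0 : 0 <= s / (s + t) by rewrite divr_ge0// ltW.
  have l1 : s / (s + t) <= 1 by rewrite ler_pdivrMr// mul1r lerDl.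
  have := cC y z (Itv01 l0 l1); rewrite !inE => /(_ Cy Cz) Cyz.
  eexists; first exact: Cyz.
  rewrite /conv/= scalerDr !scalerA; congr (_ *: _ + _ *: _).
    by rewrite mulrC divfK.
  by rewrite /onem mulrBr mulr1 [_ * (s / _)]mulrC divfK// addrC addKr.
- move=> i _; split=> //; have [/bJ ->|iJ] := boolP (i \notin J).
    by exists (q i0) => //; rewrite !scale0r.
  by exists (q i) => //; apply: qC; exists i => //; apply/negbNE.
Qed.
End Hull.

(** * Conic Caratheodory theorem *)

Section Caratheodory.
Variables (R : realType) (d : nat) (I : finType) (w : I -> 'rV[R]_d).

(** The sign of the sum can be chosen because -c is a relation whenever c is;
    a nonzero c with nonnegative sum has a positive entry. *)
Lemma linear_dependence (J : {set I}) : (d < #|J|)%N ->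
  exists c : I -> R, [/\ forall i, i \notin J -> c i = 0,
    \sum_i c i *: w i = 0, 0 <= \sum_i c i & exists i, 0 < c i].
Proof.
move=> dJ; pose A := \matrix_(k < #|J|) w (enum_val k).
have [c [cJ cw [i ci]]] : exists c : I -> R, [/\ forall i, i \notin J -> c i = 0,
    \sum_i c i *: w i = 0 & exists i, c i != 0].
  have /rowV0Pn [u /sub_kermxP uA u0] : kermx A != 0.
    by rewrite kermx_eq0 /row_free neq_ltn (leq_ltn_trans (rank_leq_col A)).
  exists (fun i => \sum_(k | enum_val k == i) u 0 k); split.
  - move=> i iJ; rewrite big1// => k /eqP ki.
    by move: iJ; rewrite -ki enum_valP.
  - rewrite -[RHS]uA mulmx_sum_row (partition_big enum_val xpredT)//=.
    apply: eq_bigr => i _; rewrite scaler_suml; apply: eq_bigr => k /eqP <-.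
    by rewrite rowK.
  - have [k uk] : exists k, u 0 k != 0.
      apply: contrapT => /forallNP h; case/eqP: u0; apply/rowP => k.
      by rewrite mxE; apply/eqP/negPn/negP; exact: h.
    exists (enum_val k); rewrite (big_pred1 k)// => l.
    by rewrite (inj_eq enum_val_inj).
wlog c0 : c cJ cw ci / 0 <= \sum_i c i => [h|].
  have [|/ltW c0] := leP 0 (\sum_i c i); first exact: h.
  apply: (h (fun i => - c i)).
  - by move=> j /cJ ->; rewrite oppr0.
  - rewrite (eq_bigr (fun i => - (c i *: w i))) => [|j _]; last by rewrite scaleNr.
    by rewrite sumrN cw oppr0.
  - by rewrite oppr_eq0.
  - by rewrite sumrN oppr_ge0.
exists c; split=> //; apply: contrapT => /forallNP h.
have cle0 j : 0 <= - c j by rewrite oppr_ge0 leNgt; apply/negP/h.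
have : \sum_j - c j = 0.
  by apply/eqP; rewrite eq_le sumr_ge0// sumrN oppr_le0 c0.
move=> /psumr_eq0P => /(_ (fun j _ => cle0 j)) /(_ i isT) /eqP.
by rewrite oppr_eq0 (negPf ci).
Qed.

(** Subtracting from the coefficients the largest admissible multiple of a
    linear relation with nonnegative sum kills one coefficient, and the total
    weight can only decrease. Affine relations, which would preserve the weight,
    would only bring the number of points down to d + 1. *)
Lemma conic_caratheodory (J : {set I}) t x : cone_comb w J t x ->
  exists (J' : {set I}) (t' : R),
    [/\ (#|J'| <= d)%N, t' <= t & cone_comb w J' t' x].
Proof.
elim/ltn_ind: {J}#|J| {-2}J (erefl #|J|) t => n IH J Jn t xt.
have [Jd|dJ] := leqP #|J| d; first by exists J, t.
have [c [cJ cw c0 [i1 ci1]]] := linear_dependence dJ.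
have [b [b0 bJ <- bx]] := xt.
pose i0 := [arg min_(i < i1 | 0 < c i) (b i / c i)]%O.
have [ci0 mini0] : 0 < c i0 /\ forall j, 0 < c j -> b i0 / c i0 <= b j / c j.
  by rewrite /i0; case: arg_minP.
have i0J : i0 \in J by apply: contraTT ci0 => /cJ ->; rewrite ltxx.
pose s := b i0 / c i0.
have s0 : 0 <= s by rewrite divr_ge0// ltW.
have := IH #|J :\ i0| _ (J :\ i0) erefl (\sum_i b i - s * \sum_i c i).
case.
- by rewrite -Jn [in X in (_ < X)%N](cardsD1 i0) i0J.
- exists (fun i => b i - s * c i); split.
  + move=> i; rewrite subr_ge0; have [ci|ci] := ltP 0 (c i).
      by rewrite -ler_pdivlMr//; exact: mini0.
    by rewrite (le_trans _ (b0 i))// mulr_ge0_le0.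
  + move=> i; rewrite !inE negb_and negbK => /orP[/eqP ->|iJ].
      by rewrite /s divfK ?subrr// gt_eqF.
    by rewrite bJ// cJ// mulr0 subrr.
  + by rewrite sumrB mulr_sumr.
  + rewrite -bx (eq_bigr (fun i => b i *: w i - s *: (c i *: w i))) => [|i _].
      by rewrite sumrB -scaler_sumr cw scaler0 subr0.
    by rewrite scalerBl scalerA.
- move=> J' [t' [cJ' t't xt']]; exists J', t'; split=> //.
  by rewrite (le_trans t't)// gerBl mulr_ge0.
Qed.
End Caratheodory.

(** * A basis of maximal volume *)

Section MaxVolume.
Variables (R : realType) (d m : nat).

Lemma det_replace_row_id (a : 'rV[R]_d) k :
  \det (\matrix_i (if i == k then a else delta_mx 0 i)) = a 0 k.
Proof.
rewrite (expand_det_col _ k) (bigD1 k)//= big1 ?addr0 => [|i ik].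
  rewrite mxE eqxx /cofactor -signr_odd oddD addbb expr0 mul1r.
  rewrite (_ : row' _ _ = 1%:M) ?det1 ?mulr1//; apply/matrixP => i j.
  by rewrite !mxE eq_sym (negPf (neq_lift _ _)) mxE eqxx (inj_eq lift_inj) eq_sym.
by rewrite mxE (negPf ik) mxE eqxx eq_sym (negPf ik) mul0r.
Qed.

(** Replacing the k-th basis vector by another row multiplies the determinant by
    the k-th coordinate of that row, which maximality bounds by 1. *)
Lemma max_volume_basis (W : 'M[R]_(m, d)) : row_full W ->
  exists e : 'I_d -> 'I_m, injective e /\
    forall i, exists2 a : 'rV_d, row i W = a *m rowsub e W &
      forall k, `|a 0 k| <= 1.
Proof.
move=> Wfull; pose vol (f : {ffun 'I_d -> 'I_m}) := `|\det (rowsub f W)|.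
pose e := [arg max_(f > fullrankfun Wfull) vol f]%O.
have emax f : vol f <= vol e by rewrite /e; case: arg_maxP => // f' _; exact.
have vole : 0 < vol e.
  rewrite (lt_le_trans _ (emax (fullrankfun Wfull)))// normr_gt0 -unitfE.
  exact: fullrowsub_unit.
have eunit : rowsub e W \in unitmx by rewrite unitmxE unitfE -normr_gt0.
exists e; split=> [k l kl|i].
  apply/eqP/negPn/negP => kNl; move: vole; rewrite normr_gt0.
  rewrite (determinant_alternate kNl) ?eqxx// => j.
  by rewrite !mxE kl.
pose a := row i W *m invmx (rowsub e W).
have aE : row i W = a *m rowsub e W by rewrite mulmxKV.
exists a => // k.
pose f := [ffun l => if l == k then i else e l].
have fE : rowsub f W =
    \matrix_l (if l == k then a else delta_mx 0 l) *m rowsub e W.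
  apply/row_matrixP => l; rewrite row_mul rowK row_rowsub ffunE.
  by case: eqP => // _; rewrite -rowE row_rowsub.
have := emax f; rewrite /vol fE det_mulmx det_replace_row_id normrM.
by rewrite ger_pMl.
Qed.
End MaxVolume.

(** * The analytic centre of the polar polytope *)

Section AnalyticCenter.
Variable (R : realType).

(** The sum is the derivative at 0 of the product, as a polynomial in t, and the
    product has a local maximum there. *)
Lemma sum0_of_prod_le1 (I : finType) (a : I -> R) :
  (forall t, (forall i, 0 <= 1 + t * a i) -> \prod_i (1 + t * a i) <= 1) ->
  \sum_i a i = 0.
Proof.
move=> a_le1; pose P : {poly R} := \prod_i (1 + a i *: 'X).
have hornP t : P.[t] = \prod_i (1 + t * a i).
  by rewrite horner_prod; apply: eq_bigr => i _; rewrite !hornerE mulrC.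
have derivP : P^`().[0] = \sum_i a i.
  rewrite /P; suff [//] : (\prod_i (1 + a i *: 'X)).[0] = 1 /\
    (\prod_i (1 + a i *: 'X))^`().[0] = \sum_i a i.
  apply: (big_rec2 (fun (p : {poly R}) s => p.[0] = 1 /\ p^`().[0] = s)).
    by rewrite derivC !hornerE.
  move=> i s p _ [p0 p'0].
  by rewrite derivM derivD derivC derivZ derivX !hornerE p0 p'0; lra.
(* For |t| < 1/D all the factors are nonnegative. *)
pose D : R := 1 + \sum_i `|a i|.
have D0 : 0 < D by rewrite ltr_pwDl// sumr_ge0.
have itv0 : 0 \in `](- D^-1), D^-1[.
  by rewrite in_itv/= oppr_lt0 invr_gt0 D0.
have max0 t : t \in `](- D^-1), D^-1[ -> P.[t] <= P.[0].
  rewrite in_itv/= -ltr_norml => tD; rewrite !hornP.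
  rewrite [leRHS]big1 => [|i _]; last by rewrite mul0r addr0.
  apply: a_le1 => i; suff : `|t * a i| <= 1 by rewrite ler_norml; lra.
  rewrite normrM -[leRHS](mulVf (lt0r_neq0 D0)); apply: ler_pM => //.
    exact: ltW.
  by rewrite /D (bigD1 i)//= addrCA lerDl addr_ge0// sumr_ge0.
have DD : - D^-1 <= D^-1 by rewrite -subr_ge0 opprK addr_ge0// invr_ge0 ltW.
have der0 := derive1_at_max DD (fun t _ => @derivable_horner _ P t) itv0 max0.
rewrite -derivP; have derP := is_derive_poly P 0.
by rewrite -(@derive_val _ _ _ _ _ _ _ derP) (@derive_val _ _ _ _ _ _ _ der0).
Qed.

Definition dot d (x y : 'rV[R]_d) : R := (x *m y^T) 0 0.

Lemma dotE d (x y : 'rV[R]_d) : dot x y = \sum_j x 0 j * y 0 j.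
Proof. by rewrite /dot mxE; apply: eq_bigr => j _; rewrite mxE. Qed.

Lemma dotDr d (x y z : 'rV[R]_d) : dot x (y + z) = dot x y + dot x z.
Proof. by rewrite /dot linearD mulmxDr mxE. Qed.

Lemma dotZr d k (x y : 'rV[R]_d) : dot x (k *: y) = k * dot x y.
Proof. by rewrite /dot linearZ -scalemxAr mxE. Qed.

Lemma dotZl d k (x y : 'rV[R]_d) : dot (k *: x) y = k * dot x y.
Proof. by rewrite /dot -scalemxAl mxE. Qed.

Lemma dotNl d (x y : 'rV[R]_d) : dot (- x) y = - dot x y.
Proof. by rewrite /dot mulNmx mxE. Qed.

Lemma dot_suml d (I : finType) (F : I -> 'rV[R]_d) y :
  dot (\sum_i F i) y = \sum_i dot (F i) y.
Proof. by rewrite /dot mulmx_suml summxE. Qed.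

Lemma dot_delta d (x : 'rV[R]_d) j : dot x (delta_mx 0 j) = x 0 j.
Proof. by rewrite /dot trmx_delta -colE mxE. Qed.

Lemma dotC d (x y : 'rV[R]_d) : dot x y = dot y x.
Proof. by rewrite !dotE; apply: eq_bigr => j _; rewrite mulrC. Qed.

Lemma dot_continuous d (x : 'rV[R]_d) : continuous (dot x).
Proof.
rewrite (_ : dot x = fun y => \sum_j x 0 j * y 0 j); last first.
  by apply/funext => y; rewrite dotE.
refine (@continuous_big R _ +%R 0 xpredT (@add_continuous R) _ _ _ _) => j _ y.
exact: (cvgM (cvg_cst _) (@coord_continuous _ _ _ _ _ _)).
Qed.

(** The maximizer of the product of the slacks 1 - <q_i, c> is interior, and the
    logarithmic gradient of the product vanishes there. *)
Lemma analytic_center d (I : finType) (q : I -> 'rV[R]_d) :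
  (forall c, (forall i, dot (q i) c <= 1) -> forall j, `|c 0 j| <= 1) ->
  exists2 c, forall i, dot (q i) c < 1 &
    \sum_i (1 - dot (q i) c)^-1 *: q i = 0.
Proof.
move=> polar_bounded.
pose K := [set c : 'rV[R]_d | forall i, dot (q i) c <= 1].
pose f c := \prod_i (1 - dot (q i) c).
have K0 : K 0 by move=> i; rewrite dotE big1 ?ler01// => j _; rewrite mxE mulr0.
have cptK : compact K.
  apply: (@subclosed_compact _ _
      [set c : 'rV[R]_d | forall j, `[(-1), 1]%classic (c ord0 j)]).
  - rewrite (_ : K = \bigcap_i (dot (q i) @^-1` [set t | t <= 1])); last first.
      by apply/seteqP; split => c Kc i; [move=> _; exact: Kc|exact: Kc].
    apply: closed_bigI => i _; apply: preimage_closed; last exact: closed_le.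
    by move=> y _; exact: (@dot_continuous _ (q i) y).
  - apply: (@rV_compact R d (fun=> `[(-1), 1]%classic)) => _.
    exact: segment_compact.
  - by move=> c Kc j /=; rewrite in_itv/= -ler_norml; exact: polar_bounded.
have cf : {within K, continuous f}.
  apply: continuous_subspaceT.
  refine (@continuous_big R _ *%R 1 xpredT (@mul_continuous R) _ _ _ _) => i _ c.
  exact: (cvgB (cvg_cst _) (@dot_continuous _ _ _)).
have [c /set_mem Kc cmax] := EVT_max_rV (ex_intro _ 0 K0) cptK cf.
have fc : 0 < f c.
  rewrite (lt_le_trans _ (cmax 0 (mem_set K0)))// prodr_gt0// => i _.
  by rewrite dotC dotE big1 ?subr0// => j _; rewrite mxE mul0r.
have s0 i : 0 < 1 - dot (q i) c.
  rewrite lt_def subr_ge0 Kc andbT; apply: contraTneq fc => si.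
  by rewrite /f (bigD1 i)//= si mul0r ltxx.
exists c => [i|]; first by rewrite -subr_gt0.
apply/rowP => j; rewrite summxE mxE.
rewrite (eq_bigr (fun i => (1 - dot (q i) c)^-1 * q i 0 j)) => [|i _]; last first.
  by rewrite mxE.
apply/eqP; rewrite -oppr_eq0 -sumrN; apply/eqP.
apply: sum0_of_prod_le1 => t tge0.
(* Relative to their values at c, the slacks along a coordinate line through c
   are of the form 1 + t a_i. *)
have sE i : 1 - dot (q i) (c + t *: delta_mx 0 j) =
    (1 - dot (q i) c) * (1 + t * - ((1 - dot (q i) c)^-1 * q i 0 j)).
  rewrite dotDr dotZr dot_delta; field.
  exact: lt0r_neq0.
have := cmax (c + t *: delta_mx 0 j); rewrite /f.
under eq_bigr do rewrite sE.
rewrite big_split/= ger_pMr//; apply; apply/mem_set => i.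
by rewrite -subr_ge0 sE mulr_ge0// ltW.
Qed.
End AnalyticCenter.

(** * Selection of 2d points *)

Section SymmetricSteinitz.
Variables (R : realType) (d m : nat).

(** The map x |-> x / (1 - <x, c>) is projective, hence compatible with convex
    hulls; on coefficients it multiplies b_i by 1 - <q_i, c>. *)
Lemma cone_comb_rescale (I : finType) (q : I -> 'rV[R]_d) c (J : {set I}) x :
  (forall i, dot (q i) c < 1) ->
  cone_comb (fun i => (1 - dot (q i) c)^-1 *: q i) J (1 - dot x c) x ->
  cone_comb q J 1 x.
Proof.
move=> qc [b [b0 bJ bt bx]].
have s0 i : 0 < 1 - dot (q i) c by rewrite subr_gt0.
exists (fun i => b i / (1 - dot (q i) c)); split.
- by move=> i; rewrite divr_ge0// ltW.
- by move=> i /bJ ->; rewrite mul0r.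
- have bc : \sum_i b i / (1 - dot (q i) c) * dot (q i) c = dot x c.
    rewrite -[in RHS]bx dot_suml; apply: eq_bigr => i _.
    by rewrite scalerA dotZl.
  rewrite -[RHS](subrK (dot x c)) -[X in _ = X + _]bt -bc -big_split/=.
  apply: eq_bigr => i _; field; exact: lt0r_neq0.
- by rewrite -[RHS]bx; apply: eq_bigr => i _; rewrite scalerA.
Qed.

Lemma cone_comb_unrescale (I : finType) (q : I -> 'rV[R]_d) c (J : {set I}) x :
  (forall i, dot (q i) c < 1) -> cone_comb q J 1 x ->
  cone_comb (fun i => (1 - dot (q i) c)^-1 *: q i) J (1 - dot x c) x.
Proof.
move=> qc [b [b0 bJ bt bx]].
have s0 i : 0 < 1 - dot (q i) c by rewrite subr_gt0.
exists (fun i => b i * (1 - dot (q i) c)); split.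
- by move=> i; rewrite mulr_ge0// ltW.
- by move=> i /bJ ->; rewrite mul0r.
- have -> : 1 - dot x c = \sum_i b i - dot (\sum_i b i *: q i) c by rewrite bt bx.
  rewrite dot_suml -sumrB; apply: eq_bigr => i _.
  by rewrite dotZl mulrBr mulr1.
- by rewrite -[RHS]bx; apply: eq_bigr => i _; rewrite scalerA mulfK// lt0r_neq0.
Qed.

(** A quantitative Steinitz theorem for points with sum zero: up to the factor
    m + d in the weight, 2d of the points represent everything that all of
    them do. *)
Lemma centered_steinitz (w : 'I_m -> 'rV[R]_d) :
  (0 < d)%N -> row_full (\matrix_i w i) -> \sum_i w i = 0 ->
  exists J : {set 'I_m}, (#|J| <= 2 * d)%N /\
    forall h t t' x, cone_comb w finset.setT t x -> t <= h ->
      h * (m + d)%:R <= t' -> cone_comb w J t' x.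
Proof.
move=> d0 wfull w0; have [e [e_inj coord]] := max_volume_basis wfull.
pose E := e @: (finset.setT : {set 'I_d}) : {set 'I_m}.
have cardE : #|E| = d by rewrite card_imset// cardsT card_ord.
have sumE (V : nmodType) (F : 'I_m -> V) : \sum_(i in E) F i = \sum_k F (e k).
  rewrite big_imset/=; last by move=> k l _ _; exact: e_inj.
  by apply: eq_bigl => k; rewrite finset.in_setT.
pose y := - \sum_k w (e k).
have yE : cone_comb w (~: E) (m%:R - d%:R) y.
  have -> : y = \sum_(i in ~: E) w i.
    have := w0; rewrite (bigID (mem E))/= sumE => /eqP.
    rewrite addrC addr_eq0 => /eqP; rewrite -/y => <-.
    by apply: eq_bigl => i; rewrite inE.
  have -> : m%:R - d%:R = \sum_(i in ~: E) (1 : R).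
    rewrite sumr_const -cardE -{1}(card_ord m) -(cardsC E) natrD.
    by rewrite addrAC subrr add0r.
  by apply: cone_comb_sum => i; exact: cone_comb_pt.
have [J0 [T [cardJ0 Tle yJ0]]] := conic_caratheodory yE.
have T0 : 0 <= T by case: yJ0 => b [b0 _ <- _]; exact: sumr_ge0.
exists (E :|: J0); split.
  by rewrite (leq_trans (leq_card_setU _ _))// cardE mul2n -addnn leq_add2l.
move=> h t t' x [b [b0 _ bt bx]] th ht'.
have [a ax ah] : exists2 a : 'I_d -> R,
    x = \sum_k a k *: w (e k) & forall k, `|a k| <= h.
  have /choice[a aP] : forall i, exists a : 'rV_d,
      w i = \sum_k a 0 k *: w (e k) /\ forall k, `|a 0 k| <= 1.
    move=> i; have [a aE a1] := coord i; exists a; split=> //.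
    rewrite -[LHS](rowK (fun i => w i)) aE mulmx_sum_row; apply: eq_bigr => k _.
    by rewrite row_rowsub rowK.
  exists (fun k => \sum_i b i * a i 0 k).
    rewrite -bx; under eq_bigr do rewrite (aP _).1 scaler_sumr.
    rewrite exchange_big; apply: eq_bigr => k _; rewrite scaler_suml.
    by apply: eq_bigr => i _; rewrite scalerA.
  move=> k; apply: le_trans th; rewrite -bt.
  apply: (le_trans (ler_norm_sum _ _ _)); apply: ler_sum => i _.
  by rewrite normrM ger0_norm// ler_piMr// (aP i).2.
have h0 : 0 <= h by exact: le_trans (ah (Ordinal d0)).
have dT : 0 < d%:R + T by rewrite ltr_pwDl// ltr0n.
(* The multiple s of the relation sum_k w (e k) + y = 0 is the one that gives
   the total weight t'. *)
pose s := (t' - \sum_k a k) / (d%:R + T).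
have hs : h <= s.
  rewrite ler_pdivlMr//.
  have sum_a : \sum_k a k <= h * d%:R.
    rewrite -[X in _ * X%:R](card_ord d) -sumr_const mulr_sumr.
    by apply: ler_sum => k _; rewrite mulr1 (le_trans (ler_norm _)).
  have hT : h * T <= h * (m%:R - d%:R) by rewrite ler_wpM2l.
  by move: ht'; rewrite natrD; lra.
have -> : x = \sum_k (a k + s) *: w (e k) + s *: y.
  rewrite scalerN scaler_sumr -sumrB ax; apply: eq_bigr => k _.
  by rewrite scalerDl addrK.
have -> : t' = \sum_k (a k + s) * 1 + s * T.
  rewrite (eq_bigr (fun k => a k + s)) => [|k _]; last by rewrite mulr1.
  rewrite big_split/= sumr_const card_ord -mulr_natr -addrA -mulrDr.
  by rewrite divfK ?lt0r_neq0// subrKC.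
apply: cone_combD.
  apply: cone_comb_sum => k _; apply: cone_combZ.
    have := le_trans hs (lexx s); have := ah k; rewrite ler_norml => /andP[+ _].
    by lra.
  by apply: cone_comb_pt; rewrite inE imset_f.
apply: cone_combZ; first exact: le_trans hs.
by apply: cone_comb_sub yJ0; exact: finset.subsetUr.
Qed.

(** Symmetry of B gives |<x, c>| <= 1 for x in B and c in the polar set of the
    points; applied to the standard basis vectors, this bounds the polar set.
    The same vectors show that the points span the space. *)
Lemma symmetric_steinitz (q : 'I_m -> 'rV[R]_d) (B : set 'rV[R]_d) :
  (0 < d)%N ->
  (forall x, B x -> B (- x)) -> (forall j, B (delta_mx 0 j)) ->
  B `<=` cone_comb q finset.setT 1 ->
  exists J : {set 'I_m}, (#|J| <= 2 * d)%N /\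
    forall x, B x -> cone_comb q J 1 ((2 * (m + d) + 1)%:R^-1 *: x).
Proof.
move=> d0 BN Be Bq.
have dotB c x : (forall i, dot (q i) c <= 1) -> B x -> `|dot x c| <= 1.
  have dot_le z : (forall i, dot (q i) c <= 1) -> B z -> dot z c <= 1.
    move=> qc /Bq [b [b0 _ bt <-]]; rewrite dot_suml -bt; apply: ler_sum => i _.
    by rewrite dotZl ler_piMr.
  move=> qc Bx; rewrite ler_norml dot_le// andbT lerNl -dotNl.
  by apply: dot_le => //; exact: BN.
have [|c qc w0] := @analytic_center R d _ q.
  by move=> c qc j; rewrite -dot_delta dotC; exact: dotB.
have xc x : B x -> `|dot x c| <= 1 by apply: dotB => i; exact: ltW.
pose w i := (1 - dot (q i) c)^-1 *: q i.
have Bw x : B x -> cone_comb w finset.setT (1 - dot x c) x.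
  by move=> Bx; apply: cone_comb_unrescale => //; exact: Bq.
have wfull : row_full (\matrix_i w i).
  rewrite -sub1mx; apply/row_subP => j; rewrite row1.
  have [b [_ _ _ <-]] := Bw _ (Be j).
  apply: summx_sub => i _; apply: scalemx_sub.
  by rewrite -[w i](rowK (fun i => w i)) row_sub.
have [J [cardJ wJ]] := centered_steinitz d0 wfull w0.
exists J; split=> // x Bx; set r := _^-1.
have rE : r * (2 * (m%:R + d%:R) + 1) = 1.
  by rewrite -natrD -natrM natr1 /r addn1 mulVf// pnatr_eq0.
have r0 : 0 <= r by rewrite invr_ge0.
have := xc x Bx; rewrite ler_norml => /andP[xc1 xc2].
apply: (@cone_comb_rescale _ q c) => //.
apply: (wJ (2 * r) (r * (1 - dot x c))).
- exact: cone_combZ (Bw x Bx).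
- by rewrite mulrC ler_wpM2r//; lra.
- rewrite dotZl natrD.
  have : r * dot x c <= r by rewrite ler_piMr.
  by lra.
Qed.
End SymmetricSteinitz.

(** * The Euclidean ball *)

Section UnitBall.
Variables (R : realType) (d : nat).

Lemma unit_ballN (x : 'rV[R]_d) : unit_ball R d x -> unit_ball R d (- x).
Proof.
rewrite /unit_ball /enorm/= => x1; under eq_bigr do rewrite mxE sqrrN.
exact: x1.
Qed.

Lemma unit_ball_delta j : unit_ball R d (delta_mx 0 j).
Proof.
rewrite /unit_ball /enorm/= (bigD1 j)//= big1 => [|i ij].
  by rewrite mxE !eqxx expr1n addr0 sqrtr1.
by rewrite mxE (negPf ij) andbF expr0n.
Qed.
End UnitBall.

Theorem theorem1p2 (R : realType) (d m : nat) (hd : (0 < d)%N) (hm : (0 < m)%N)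
    (Q : {fset 'rV[R]_d}) (hQ : #|` Q| = m)
    (hball : unit_ball R d `<=` convex_hull [set` Q]) :
  exists Q' : {fset 'rV[R]_d},
    [/\ (Q' `<=` Q)%fset, (#|` Q'| <= 2 * d)%N &
        dilate ((2 * (m + d) + 1)%:R^-1) (unit_ball R d)
          `<=` convex_hull [set` Q']].
Proof.
pose q (i : 'I_m) : 'rV[R]_d := nth 0 (enum_fset Q) i.
have qQ i : q i \in Q.
  by apply: mem_nth; rewrite -[size _]/(#|` Q|) hQ.
have rangeq : [set` Q] = range q.
  apply/seteqP; split=> [x /= xQ|_ [i _ <-]]; last exact: qQ.
  have iQ : (index x (enum_fset Q) < m)%N by rewrite -hQ index_mem.
  by exists (Ordinal iQ) => //; rewrite /q/= nth_index.
have [|||J [cardJ qJ]] := @symmetric_steinitz R d m q (unit_ball R d) hd.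
- exact: unit_ballN.
- exact: unit_ball_delta.
- by rewrite rangeq in hball; apply: (subset_trans hball); exact: hull_cone_comb.
exists [fset q i | i in J]%fset; split.
- by apply/fsubsetP => _ /imfsetP[i _ ->].
- apply: leq_trans cardJ.
  by rewrite (leq_trans (leq_imfset_card _ _ _))//= -cardE.
- move=> _ [x Bx <-]; rewrite (_ : [set` _] = q @` [set` J]).
    by apply: cone_comb_hull; exact: qJ.
  apply/seteqP; split=> [z /imfsetP[i iJ ->]|_ [i iJ <-]]; first by exists i.
  by apply/imfsetP; exists i.
Qed.
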